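(* Let $P=\{1423\}$ and, for $n\ge1$ and $l\ge0$, let $c_{n,l}$ be the number of permutations of $\{1,\dots,n\}$ that are $(l+1)$-chains for $P$ (i.e. are obtained by linking $l$ occurrences of $1423$); set $c_{n,l}=0$ for $l<0$. Then $c_{1,l}=\delta_{0,l}$, $c_{2,l}=c_{3,l}=0$, and for all $n\ge4$ and $l\ge0$, $$c_{n,l}=\sum_{k\ge1,\ 2k+2\le n}\binom{n-k-2}{k}\,c_{n-2k-1,\,l-k}.$$ Consequently the exponential generating function of permutations avoiding $1423$ is $$g_{\{1423\}}(t)=\Big(1-t-\sum_{n\ge2,\,l\ge1}\frac{(-1)^l c_{n,l}}{n!}t^n\Big)^{-1}.$$
   Context: For a word $s=s_1\dots s_j$ of distinct integers, $\mathrm{st}(s)$ is the permutation $\rho$ of $\{1,\dots,j\}$ with $s_i<s_r\iff\rho_i<\rho_r$; an occurrence of a pattern $\pi$ of length $j$ in a word $w$ is a factor $w_i\dots w_{i+j-1}$ with $\mathrm{st}(w_i\dots w_{i+j-1})=\pi$; a permutation avoids $\pi$ if it has no occurrence. $g_P(t)=1+\sum_{n\ge1}\frac{a^P_n}{n!}t^n$ with $a^P_n$ the number of permutations of $\{1,\dots,n\}$ avoiding all patterns of $P$. Chains and tails: the empty word is a $0$-chain, its own tail; each one-letter word is a $1$-chain, its own tail; for $q\ge2$ a $q$-chain is a word $\sigma$ with a factorization $\sigma=\sigma'\tau$ where $\sigma'$ is a $(q-1)$-chain with tail $\tau'$ and $\tau'\tau$ contains exactly one occurrence of a pattern from $P$,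 this occurrence being a suffix of $\tau'\tau$; $\tau$ is the tail of $\sigma$. $\delta$ is the Kronecker delta.
   Formalization: In the definition of a q-chain, the new tail τ is also required to be shorter than the pattern, so that the occurrence starts inside the previous tail τ'; without this 51423 would be a 2-chain, giving c_{5,1}=5 while the recurrence gives 0. *)

(* Defs.v *)
From HB Require Import structures.
From mathcomp Require Import all_boot all_order all_fingroup all_algebra.
From mathcomp Require Import boolp classical_sets fsbigop.

Set Implicit Arguments.
Unset Strict Implicit.
Unset Printing Implicit Defensive.

Import Order.TTheory GRing.Theory Num.Theory.

Definition st (s : seq nat) : seq nat :=
  [seq count (fun y => y <= x) s | x <- s].

(* [st_perm] and [st_lt] say that, on words of distinct letters, [st s] is the
   permutation order-isomorphic to [s]. *)
Lemma st_lt (s : seq nat) (i r : nat) :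
  i < size s -> r < size s ->
  (nth 0 s i < nth 0 s r) = (nth 0 (st s) i < nth 0 (st s) r).
Proof.
move=> Hi Hr; rewrite /st !(nth_map 0) //.
set x := nth 0 s i; set y := nth 0 s r.
have mono a b : a <= b -> count (fun z => z <= a) s <= count (fun z => z <= b) s.
  by move=> ab; apply: sub_count => z /= za; apply: leq_trans ab.
case: (ltnP x y) => [xy|yx]; last by apply/esym/negbTE; rewrite -leqNgt mono.
apply/esym.
have -> : count (fun z => z <= y) s =
    count (fun z => z <= x) s + count (fun z => x < z <= y) s.
  rewrite -(count_predUI (fun z => z <= x) (fun z => x < z <= y) s).
  rewrite [X in _ + X](_ : _ = 0) ?addn0; last first.
    apply/eqP; rewrite -leqn0 leqNgt -has_count; apply/hasPn => z _ /=.
    by case: (leqP z x).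
  apply: eq_count => z /=; case: (leqP z x) => //= zx.
  exact: leq_trans zx (ltnW xy).
rewrite -addn1 leq_add2l -has_count; apply/hasP.
by exists y; [exact: mem_nth | rewrite xy leqnn].
Qed.

Lemma st_perm (s : seq nat) : uniq s -> perm_eq (st s) (iota 1 (size s)).
Proof.
move=> us.
have sz : size (st s) = size s by rewrite size_map.
have ust : uniq (st s).
  apply/(uniqP 0) => i r; rewrite !inE sz => Hi Hr e.
  apply/eqP; rewrite -(nth_uniq 0 Hi Hr us) eqn_leq.
  by rewrite leqNgt (st_lt Hr Hi) e ltnn /= leqNgt (st_lt Hi Hr) e ltnn.
have sub : {subset st s <= iota 1 (size s)}.
  move=> z /mapP[x xs ->]; rewrite mem_iota add1n ltnS count_size andbT -has_count.
  by apply/hasP; exists x.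
apply: uniq_perm => //; first exact: iota_uniq.
by apply: (uniq_min_size ust sub _).2; rewrite size_iota sz.
Qed.

Definition occurs (p w : seq nat) (i : nat) : bool :=
  (i + size p <= size w) && (st (take (size p) (drop i w)) == p).

Definition avoids (P : seq (seq nat)) (w : seq nat) : Prop :=
  forall p i, p \in P -> ~~ occurs p w i.

(* [t' ++ t] contains exactly one occurrence of a pattern from [P], and that
   occurrence is a suffix.  The clause [size t < size p] says that the
   occurrence starts inside the previous tail [t'], i.e. that it is really
   linked to what precedes; without it 51423 would be a 2-chain for 1423. *)
Definition links (P : seq (seq nat)) (t' t : seq nat) : Prop :=
  exists p i,
    [/\ p \in P, occurs p (t' ++ t) i, i + size p = size (t' ++ t),
        size t < size p
      & forall p' i', p' \in P -> occurs p' (t' ++ t) i' -> p' = p /\ i' = i].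

(* [chain P q s t]: [s] is a [q]-chain with tail [t]. *)
Inductive chain (P : seq (seq nat)) : nat -> seq nat -> seq nat -> Prop :=
| Chain0 : chain P 0 [::] [::]
| Chain1 (x : nat) : chain P 1 [:: x] [:: x]
| ChainS (q : nat) (s' t' t : seq nat) :
    chain P q.+1 s' t' -> links P t' t -> chain P q.+2 (s' ++ t) t.

Definition is_chain (P : seq (seq nat)) (q : nat) (s : seq nat) : Prop :=
  exists t, chain P q s t.

(* One-line notation, with letters in {1, ..., n}. *)
Definition word (n : nat) (s : 'S_n) : seq nat := [seq (s i).+1 | i <- enum 'I_n].

Definition avoid_num (P : seq (seq nat)) (n : nat) : nat :=
  #|[set s : 'S_n | `[< avoids P (word s) >]]%SET|.

Definition chain_num (P : seq (seq nat)) (n : nat) (l : int) : nat :=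
  match l with
  | Posz m => #|[set s : 'S_n | `[< is_chain P m.+1 (word s) >]]%SET|
  | Negz _ => 0
  end.

Local Open Scope ring_scope.

(* Formal power series over the rationals, given by their coefficients. *)
Definition fps := nat -> rat.

Definition fps_one : fps := fun n => (n == 0%N)%:R.

Definition fps_X : fps := fun n => (n == 1%N)%:R.

Definition fps_sub (f g : fps) : fps := fun n => f n - g n.

Definition fps_mul (f g : fps) : fps :=
  fun n => \sum_(i < n.+1) f i * g (n - i)%N.

Definition is_fps_inv (f g : fps) : Prop := fps_mul f g =1 fps_one.

Definition avoid_egf (P : seq (seq nat)) : fps :=
  fun n => if n == 0%N then 1 else (avoid_num P n)%:R / n`!%:R.

(* Main.v *)
(* Two occurrences of 1423 can overlap only in one or two letters, so an
   (l+1)-chain is a word covered by l occurrences whose successive starting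
   points differ by 3 or 2; this can be read off from the front of the word.

   Recurrence: let the first k occurrences overlap pairwise in two letters and
   the next one in a single letter.  Then
     a_1 < a_3 < ... < a_(2k+1) < a_(2k+2) < a_(2k) < ... < a_2,
   and a_(2k+2) starts a chain, hence is its minimum.  So a_1, a_3, ...,
   a_(2k+1), a_(2k+2) are the k+2 smallest letters, the k letters a_2, a_4, ...,
   a_(2k) are an arbitrary k-subset of the others, and what remains is a chain
   on n-2k-1 letters.

   Generating function: for a fixed nonempty word w, the sum of (-1)^l over the
   factorizations of w into an (l+1)-chain and an avoiding word is 1 if w avoids
   1423 and 0 otherwise.  Summing over all permutations gives the convolution
   identity. *)
Require Import Defs.
From HB Require Import structures.
From mathcomp Require Import all_boot all_order all_fingroup all_algebra.
From mathcomp Require Import boolp classical_sets fsbigop.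
From mathcomp Require Import zify ring.

Set Implicit Arguments.
Unset Strict Implicit.
Unset Printing Implicit Defensive.

Import Order.TTheory GRing.Theory Num.Theory.

(** * Occurrences of 1423 as inequalities between four consecutive letters *)

Definition p1423 : seq nat := [:: 1; 4; 2; 3].

Definition occ (w : seq nat) (i : nat) : bool :=
  [&& i + 4 <= size w, nth 0 w i < nth 0 w (i + 2),
      nth 0 w (i + 2) < nth 0 w (i + 3) & nth 0 w (i + 3) < nth 0 w (i + 1)].

Lemma st_p1423 (a b c d : nat) :
  (st [:: a; b; c; d] == p1423) = [&& a < c, c < d & d < b].
Proof.
rewrite /st /p1423 /= !eqseq_cons eqxx andbT !leqnn.
by apply/idP/idP => H; lia.
Qed.

Lemma take4_drop (w : seq nat) (i : nat) : i + 4 <= size w ->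
  take 4 (drop i w) =
  [:: nth 0 w i; nth 0 w (i + 1); nth 0 w (i + 2); nth 0 w (i + 3)].
Proof.
move=> H; apply: (@eq_from_nth _ 0) => [|j].
  by rewrite size_takel // size_drop; lia.
rewrite size_takel ?size_drop; last lia.
move=> Hj; rewrite nth_take // nth_drop.
by move: j Hj => [|[|[|[|]]]] //; rewrite addn0.
Qed.

Lemma occursE (w : seq nat) (i : nat) : occurs p1423 w i = occ w i.
Proof.
rewrite /occurs /occ -[size p1423]/4; case: (leqP (i + 4) (size w)) => // H.
by rewrite take4_drop // st_p1423.
Qed.

Lemma drop_catl (T : Type) (s t : seq T) (k : nat) :
  k <= size s -> drop k (s ++ t) = drop k s ++ t.
Proof.
rewrite drop_cat leq_eqVlt => /predU1P[->|->] //.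
by rewrite ltnn subnn drop0 drop_size.
Qed.

Lemma occ_size (w : seq nat) (i : nat) : occ w i -> i + 4 <= size w.
Proof. by case/and4P. Qed.

Lemma occ_drop (w : seq nat) (k i : nat) : occ (drop k w) i = occ w (k + i).
Proof.
rewrite /occ size_drop !nth_drop !addnA; congr andb.
by apply/idP/idP => H; lia.
Qed.

Lemma occ_catl (s t : seq nat) (i : nat) :
  i + 4 <= size s -> occ (s ++ t) i = occ s i.
Proof.
move=> H; rewrite /occ size_cat !nth_cat.
have -> : i < size s by lia.
have -> : i + 1 < size s by lia.
have -> : i + 2 < size s by lia.
have -> : i + 3 < size s by lia.
by congr andb; lia.
Qed.

Lemma occ_catr (s t : seq nat) (i : nat) : occ (s ++ t) (size s + i) = occ t i.
Proof. by rewrite -occ_drop drop_size_cat. Qed.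

Lemma occ_take (w : seq nat) (j : nat) : occ (take j w) 0 = (4 <= j) && occ w 0.
Proof.
rewrite -[w in RHS](cat_take_drop j).
case: (leqP 4 j) => Hj; last first.
  apply/negP => /occ_size; rewrite add0n size_take_min; lia.
case: (leqP 4 (size w)) => Hw.
  by rewrite occ_catl // size_take_min; lia.
by apply/idP/idP => /occ_size; rewrite ?cat_take_drop ?size_take_min; lia.
Qed.

(** An occurrence at [i] puts letter [i + 1] above letter [i + 3]; one at [i + 1] would need the
    opposite. So two occurrences never share three letters. *)
Lemma occ_succ (w : seq nat) (i : nat) : occ w i -> occ w i.+1 = false.
Proof.
move=> /and4P[_ H1 H2 H3]; apply/negP => /and4P[_].
rewrite !addSn -!addnS => H4 H5 H6; lia.
Qed.

Definition avoidb (w : seq nat) : bool :=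
  all (fun i => ~~ occ w i) (iota 0 (size w)).

Lemma avoidbP (w : seq nat) : reflect (forall i, ~~ occ w i) (avoidb w).
Proof.
apply: (iffP allP) => [H i|H i _]; last exact: H.
case: (ltnP i (size w)) => Hi; first by apply: H; rewrite mem_iota.
by apply/negP => /occ_size; lia.
Qed.

Lemma avoidsP (w : seq nat) : avoids [:: p1423] w <-> avoidb w.
Proof.
split=> [H|/avoidbP H p i].
  by apply/avoidbP => i; rewrite -occursE; apply: H; rewrite inE.
by rewrite inE => /eqP ->; rewrite occursE.
Qed.

Lemma avoidb_behead (w : seq nat) : avoidb w = ~~ occ w 0 && avoidb (drop 1 w).
Proof.
apply/avoidbP/andP => [H|[H0 /avoidbP H] [|i] //].
  by split=> //; apply/avoidbP => i; rewrite occ_drop.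
by rewrite -add1n -occ_drop.
Qed.

(** * Clusters read from the front, and their equivalence with chains *)

Fixpoint cluster (l : nat) (w : seq nat) : bool :=
  if l is l'.+1 then
    occ w 0 && (cluster l' (drop 3 w) || (0 < l') && cluster l' (drop 2 w))
  else size w == 1.

Lemma clusterS (l : nat) (w : seq nat) :
  cluster l.+1 w = occ w 0 && (cluster l (drop 3 w) || (0 < l) && cluster l (drop 2 w)).
Proof. by []. Qed.

(** A shortest cluster with [l >= 1] occurrences has all starts two apart, hence [2 * (l - 1) + 4]
    letters. The boolean term accommodates the single letter at [l = 0]. *)
Lemma cluster_size (l : nat) (w : seq nat) : cluster l w -> 2 * l + 1 < size w + (l == 0).
Proof.
elim: l w => [|l IH] w /=; first by move/eqP->.
case/andP => /occ_size H /orP[/IH|/andP[Hl /IH]]; rewrite size_drop; lia.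
Qed.

(** Both alternatives would give occurrences at the adjacent starts 3 and 2. This is what later
    turns the disjunction in [cluster] into a sum. *)
Lemma cluster_disjoint (l : nat) (w : seq nat) :
  cluster l (drop 3 w) -> 0 < l -> cluster l (drop 2 w) = false.
Proof.
case: l => // l /= /andP[H _] _; rewrite occ_drop in H.
case H2: (occ _ 0) => //; move: H2; rewrite occ_drop => /occ_succ.
by rewrite -addSn H.
Qed.

(* [chain] with the tails forgotten: only the admissible lengths of the
   appended factor remain. *)
Inductive linked : nat -> seq nat -> Prop :=
| Linked0 x : linked 0 [:: x]
| LinkedS l s t : linked l s -> (size t == 3) || (size t == 2) && (0 < l) ->
    occ (s ++ t) (size (s ++ t) - 4) -> linked l.+1 (s ++ t).

Lemma linked_size l s : linked l s -> (l == 0) && (size s == 1) || (0 < l) && (4 <= size s).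
Proof. by case=> // {}l {}s t _ _ /occ_size /=; lia. Qed.

(** Appending at the back commutes with dropping at the front, except when [s] is too short for its
    first step to survive. *)
Lemma cluster_append l s t : cluster l s -> (size t == 3) || (size t == 2) && (0 < l) ->
  occ (s ++ t) (size (s ++ t) - 4) -> cluster l.+1 (s ++ t).
Proof.
elim: l s => [|l IH] s.
  move=> /eqP Hs; rewrite ltnn andbF orbF => /eqP Ht Ho /=.
  by move: Ho; rewrite size_drop size_cat Hs Ht => ->.
rewrite [cluster _ s]clusterS => /andP[H0 H] Ht Ho; have Hs := occ_size H0.
rewrite add0n in Hs.
have Ho' k : k <= 3 -> k <= size (s ++ t) - 4 ->
    occ (drop k s ++ t) (size (drop k s ++ t) - 4).
  move=> k3 Hk; rewrite -drop_catl //; last lia.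
  rewrite occ_drop size_drop.
  by move: Ho; congr (occ _ _); lia.
have Hsc : size (s ++ t) = size s + size t by rewrite size_cat.
rewrite clusterS occ_catl // H0 !drop_catl ?andTb; try lia.
case/orP: H => [H|/andP[Hl H]]; last first.
  by apply/orP; right; apply: IH => //; [rewrite Hl|apply: Ho'; lia].
case: l => [|l] in IH H Ht *; last first.
  have := cluster_size H; rewrite size_drop => H'.
  by apply/orP; left; apply: IH => //; apply: Ho'; lia.
have Hs4 : size s = 4 by move: H => /= /eqP; rewrite size_drop; lia.
case/orP: Ht => Ht.
  apply/orP; left; apply: IH => //; first by rewrite Ht.
  by apply: Ho'; lia.
(* Here [s] is a single occurrence followed by two letters: the new occurrence starts at 2, so the
   front step changes from 3 to 2. *)
apply/orP; right; rewrite clusterS ltnn /= orbF.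
have := Ho' 2 erefl; rewrite !size_cat size_drop Hs4 (_ : size t = 2); last lia.
move=> Ho2; rewrite Ho2 /=; last lia.
by rewrite size_drop size_cat size_drop; lia.
Qed.

(** Mirror image of [cluster_append]: the appended factors are put back one by one behind [u]. *)
Lemma linked_prepend l s u : linked l s -> occ (u ++ s) 0 ->
  (size u == 3) || (size u == 2) && (0 < l) -> linked l.+1 (u ++ s).
Proof.
move=> H; elim: {l s} H => [x|l s t Hs IH Ht Ho] Hu Hsu.
  move: Hu Hsu; case: u => [|a [|b [|c [|]]]] //= Hu _.
  apply: (@LinkedS 0 [:: a] [:: b; c; x]) => //.
  exact: Linked0.
rewrite catA.
have Hstep : linked l.+1 (u ++ s) -> linked l.+2 ((u ++ s) ++ t).
  move=> Hb; apply: LinkedS => //; first by case: (size t == 3) Ht => //= /andP[->].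
  rewrite -catA size_cat -addnBA ?occ_catr //.
  by have := occ_size Ho; lia.
have := linked_size Hs; case: l => [|l] /= in Hs IH Ht Ho Hsu Hstep * => Hsz.
  case/orP: Hsu => Hsu.
    apply: Hstep; apply: IH; last by rewrite Hsu.
    by move: Hu; rewrite catA occ_catl // size_cat; lia.
  rewrite andbF orbF in Ht.
  (* Now [u ++ s] has only three letters, so the six-letter word must be cut anew: the first
     occurrence borrows one letter of [t], and the other two form the last factor. *)
  have -> : (u ++ s) ++ t = ((u ++ s) ++ take 1 t) ++ drop 1 t.
    by rewrite -[RHS]catA cat_take_drop.
  move: u Hsu Hu {IH Hstep} => [|a [|b [|]]] // _ Hu.
  move: s Hsz Hs Ho Hu => [|x [|]] // _ _ Ho Hu.
  move: t Ht Ho Hu => [|c [|d [|e [|]]]] // _ Ho Hu.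
  apply: LinkedS => //.
  apply: (@LinkedS 0 [:: a] [:: b; x; c]) => //; exact: Linked0.
apply: Hstep; apply: IH => //.
by move: Hu; rewrite catA occ_catl // size_cat; lia.
Qed.

Lemma linkedE l s : linked l s <-> cluster l s.
Proof.
split=> [|]; first by elim=> // {}l {}s t _ H1 H2 H3; exact: cluster_append.
elim: l s => [|l IH] s.
  by case: s => [|x [|]] // _; exact: Linked0.
rewrite clusterS => /andP[H0 H]; have Hs := occ_size H0.
have Hk k : k <= 3 -> linked l (drop k s) -> (k == 3) || (k == 2) && (0 < l) ->
    linked l.+1 s.
  move=> k3 Hb Hk; rewrite -(cat_take_drop k s); apply: linked_prepend => //.
    by rewrite cat_take_drop.
  by rewrite size_takel //; lia.
case/orP: H => [/IH/Hk|/andP[Hl /IH/Hk]]; first exact.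
by rewrite Hl; apply.
Qed.

Lemma linksE t' t : links [:: p1423] t' t <->
  [/\ occ (t' ++ t) (size (t' ++ t) - 4), size t < 4 &
      forall i, occ (t' ++ t) i -> i = size (t' ++ t) - 4].
Proof.
split=> [[p [i []]]|[H1 H2 H3]].
  rewrite inE => /eqP-> {p}; rewrite occursE => Ho Hi Ht Hu.
  have -> : size (t' ++ t) - 4 = i by rewrite -Hi addnK.
  split=> // j Hj; have := Hu p1423 j; rewrite inE eqxx occursE.
  by case=> [||_ ->].
exists p1423, (size (t' ++ t) - 4); rewrite occursE; split=> //.
- by have := occ_size H1; rewrite /=; lia.
- by move=> p j; rewrite inE => /eqP->; rewrite occursE => /H3.
Qed.

(* What the tail must remember so that no second occurrence can arise when the
   next factor is appended. *)
Definition good_tail l (s t : seq nat) : Prop :=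
  if l == 0 then s = t /\ size t = 1 else
  exists2 s0, s = s0 ++ t &
    ((size t == 3) || (size t == 2)) && occ s (size s - 4).

(** Uniqueness of the occurrence in [t ++ t2] amounts to a condition on lengths: that word is so
    short that any other start would be adjacent to the final occurrence or to the one ending
    [s]. *)
Lemma chain_step l s t t2 : good_tail l s t ->
  links [:: p1423] t t2 <->
  ((size t2 == 3) || (size t2 == 2) && (0 < l)) &&
  occ (s ++ t2) (size (s ++ t2) - 4).
Proof.
move=> Hg; rewrite linksE; case: l => [|l] in Hg *.
  case: Hg => -> Ht; split=> [[H1 H2 H3]|/andP[]].
    by rewrite H1; have := occ_size H1; rewrite size_cat; lia.
  rewrite andbF orbF => Ht2 H1; split=> //; first lia.
  by move=> i /occ_size; rewrite size_cat; lia.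
case: Hg => s0 -> /andP[Ht Ho].
rewrite -catA in Ho *.
have Hsz : 4 <= size (t ++ t2) ->
    occ (s0 ++ t ++ t2) (size (s0 ++ t ++ t2) - 4) =
    occ (t ++ t2) (size (t ++ t2) - 4).
  by move=> H; rewrite size_cat -addnBA // occ_catr.
have Hcl i : occ (t ++ t2) i = occ (s0 ++ t ++ t2) (size s0 + i).
  by rewrite occ_catr.
have Ho' : occ (s0 ++ t ++ t2) (size s0 + size t - 4).
  rewrite catA occ_catl ?size_cat; last by have := occ_size Ho; rewrite size_cat; lia.
  by rewrite -size_cat.
have Hs4 := occ_size Ho; rewrite size_cat in Hs4.
split=> [[H1 H2 H3]|/andP[Ht2 H1]].
  have H4 := occ_size H1; rewrite Hsz; last lia.
  rewrite H1 andbT /= andbT.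
  have Htt := size_cat t t2.
  move: H1; rewrite Hcl => H1.
  case/orP: Ht => /eqP Ht; last by lia.
  (* A one-letter [t2] would put the new occurrence one place after the last occurrence of [s]. *)
  case: (ltnP (size t2) 2) => Ht2; last lia.
  have Ht1 : size t2 = 1 by lia.
  have := occ_succ Ho'; rewrite (_ : _.+1 = size s0 + (size (t ++ t2) - 4)) ?H1 //.
  lia.
rewrite /= andbT in Ht2.
have Htt := size_cat t t2.
have H2 : 4 <= size (t ++ t2) by lia.
rewrite Hsz // in H1; split=> //; first lia.
move=> i Hi; apply/eqP; apply/negP => /negP Hne.
have Hi4 := occ_size Hi.
case: (i.+1 =P size (t ++ t2) - 4) => Hi1.
  by move: (occ_succ Hi); rewrite Hi1 H1.
(* The remaining case has start 0 while the final start is 2; it would directly follow the start of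
   the occurrence ending [s]. *)
have Hi0 : i = 0 by lia.
have Ht3 : size t = 3 by lia.
move: Hi; rewrite Hcl Hi0 (_ : _ + 0 = (size s0 + size t - 4).+1) ?occ_succ //.
lia.
Qed.

(** The equation [q = l.+1] keeps the index a variable during the induction and discards the empty
    chain. *)
Lemma chain_good_tail q s t : chain [:: p1423] q s t ->
  forall l, q = l.+1 -> good_tail l s t /\ linked l s.
Proof.
elim=> {q s t} [|x|q s t t2 Hc IH Hl] l //.
  by case=> <-; split; [|exact: Linked0].
case=> <- {l}; have [Hg Hb] := IH q erefl.
have /andP[H1 H2] := (chain_step t2 Hg).1 Hl.
split; last exact: LinkedS.
by exists s => //; rewrite H2 andbT; lia.
Qed.

Lemma linked_chain l s : linked l s -> exists t, chain [:: p1423] l.+1 s t.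
Proof.
elim=> {l s} [x|l s t _ [t' Ht'] H1 H2]; first by exists [:: x]; exact: Chain1.
have [Hg _] := chain_good_tail Ht' erefl.
by exists t; apply: ChainS Ht' _; apply/(chain_step t Hg); rewrite H1.
Qed.

Lemma is_chainE l s : is_chain [:: p1423] l.+1 s <-> cluster l s.
Proof.
rewrite -linkedE; split=> [[t /chain_good_tail/(_ l erefl)[]] //|].
exact: linked_chain.
Qed.

(** * Counting over lists of permutations: bijections and relabelling *)

Lemma perm_map_permutations (F : seq nat -> seq nat) (s t : seq nat) :
  uniq s -> uniq t -> size s = size t ->
  {in permutations s &, injective F} ->
  {in permutations s, forall w, perm_eq (F w) t} ->
  perm_eq (map F (permutations s)) (permutations t).
Proof.
move=> us ut st injF HF.
have uF : uniq (map F (permutations s)).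
  by rewrite map_inj_in_uniq ?permutations_uniq.
apply: uniq_perm; rewrite ?permutations_uniq //.
apply: (uniq_min_size uF _ _).2; last by rewrite size_map !size_permutations ?st.
by move=> _ /mapP[w /HF Hw ->]; rewrite mem_permutations.
Qed.

(** One-line notation is injective into the arrangements of 1, ..., n, and both sides have n!
    elements. *)
Lemma card_Sn_word (A : pred (seq nat)) (n : nat) :
  #|[set s : 'S_n | A (word s)]%SET| = count A (permutations (iota 1 n)).
Proof.
rewrite cardsE cardE /enum_mem size_filter -enumT.
rewrite (eq_count (a2 := preim (@word n) A)) // -count_map.
have uW : uniq (map (@word n) (enum 'S_n)).
  rewrite map_inj_uniq ?enum_uniq // => s t /eq_in_map H.
  by apply/permP => i; apply/val_inj; apply: succn_inj; apply: H; rewrite mem_enum.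
apply: (seq.permP _ A); apply: uniq_perm; rewrite ?permutations_uniq //.
apply: (uniq_min_size uW _ _).2.
  move=> _ /mapP[s _ ->]; rewrite mem_permutations.
  have -> : word s = map succn (map val (map s (enum 'I_n))).
    by rewrite -map_comp -map_comp.
  rewrite (iotaDl 1 0 n); apply: perm_map; rewrite -val_enum_ord; apply: perm_map.
  apply: uniq_perm; [|exact: enum_uniq|].
    by rewrite (map_inj_uniq (@perm_inj _ s)) enum_uniq.
  move=> i; rewrite mem_enum; apply/mapP.
  by exists ((s^-1)%g i); rewrite ?mem_enum ?permKV.
by rewrite size_map size_permutations ?iota_uniq // size_iota -cardE card_Sn.
Qed.

(** Invariance under order isomorphism. Monotonicity is asked only on the letters of [w], because
    the relabellings used are table lookups. *)
Definition order_inv (A : pred (seq nat)) : Prop :=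
  forall f w, {in w &, {mono f : x y / x < y}} -> A (map f w) = A w.

Lemma sorted_ltn_uniq (s : seq nat) : sorted ltn s -> uniq s.
Proof. by apply: sorted_uniq; [exact: ltn_trans | exact: ltnn]. Qed.

(** The increasing bijection from the letters of [s] to those of [t], applied letter by letter,
    carries the arrangements of [s] onto those of [t]. *)
Lemma count_order_inv (A : pred (seq nat)) (s t : seq nat) :
  order_inv A -> sorted ltn s -> sorted ltn t -> size s = size t ->
  count A (permutations s) = count A (permutations t).
Proof.
move=> invA ss tt st; have us := sorted_ltn_uniq ss; have ut := sorted_ltn_uniq tt.
pose f x := nth 0 t (index x s).
have mono_nth (r : seq nat) : sorted ltn r ->
    {in gtn (size r) &, {mono nth 0 r : i j / i < j}}.
  move=> rr i j Hi Hj; have S := sorted_ltn_nth ltn_trans 0 rr.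
  case: (ltngtP i j) => [ij|ji|->]; [exact: S | | exact: ltnn].
  by apply/negbTE; rewrite -leqNgt ltnW // S.
have fmono : {in s &, {mono f : x y / x < y}}.
  move=> x y xs ys; rewrite /f mono_nth ?inE -?st ?index_mem //.
  rewrite -[in RHS](nth_index 0 xs) -[in RHS](nth_index 0 ys) mono_nth //.
    by rewrite inE index_mem.
  by rewrite inE index_mem.
have finj : {in s &, injective f}.
  by move=> x y xs ys e; have := fmono x y xs ys; have := fmono y x ys xs;
     rewrite e ltnn; lia.
have fs : map f s = t.
  apply: (@eq_from_nth _ 0); rewrite size_map // => i Hi.
  by rewrite (nth_map 0) // /f index_uniq.
have sub w : w \in permutations s -> {subset w <= s}.
  by rewrite mem_permutations => /perm_mem e x; rewrite e.
have P : perm_eq (map (map f) (permutations s)) (permutations t).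
  apply: perm_map_permutations => //.
    move=> u v us' vs' e.
    have Huv : size u = size v by move/(congr1 size): e; rewrite !size_map.
    apply: (@eq_from_nth _ 0) => // i Hi.
    apply: finj.
    - by apply: (sub u) => //; rewrite mem_nth.
    - by apply: (sub v) => //; rewrite mem_nth -?Huv.
    by have := congr1 (nth 0 ^~ i) e; rewrite !(nth_map 0) -?Huv.
  by move=> w; rewrite mem_permutations -fs => Hw; apply: perm_map.
rewrite -(seq.permP P) count_map; apply: eq_in_count => w /sub Hw /=.
by rewrite invA // => x y /Hw xs /Hw ys; apply: fmono.
Qed.

Lemma occ_map (f : nat -> nat) (w : seq nat) (i : nat) :
  {in w &, {mono f : x y / x < y}} -> occ (map f w) i = occ w i.
Proof.
move=> fm; rewrite /occ size_map; case: (leqP (i + 4) (size w)) => //= H.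
have Hk k : k < 4 -> i + k < size w by lia.
have H0 : i < size w by lia.
by rewrite !(nth_map 0) ?fm ?mem_nth ?Hk.
Qed.

Lemma order_inv_avoidb : order_inv avoidb.
Proof.
move=> f w fm; rewrite /avoidb size_map; apply: eq_all => i /=.
by rewrite occ_map.
Qed.

Lemma order_inv_cluster (l : nat) : order_inv (cluster l).
Proof.
elim: l => [|l IH] f w fm; first by rewrite /= size_map.
have fmd k : {in drop k w &, {mono f : x y / x < y}}.
  by move=> x y /mem_drop xs /mem_drop ys; apply: fm.
by rewrite !clusterS occ_map // -!map_drop !IH.
Qed.

(** * Cutting a permutation after [j] letters: a [j]-subset and two arrangements *)

Fixpoint subs (s : seq nat) (j : nat) : seq (seq nat) :=
  match j, s with
  | 0, _ => [:: [::]]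
  | _.+1, [::] => [::]
  | j'.+1, a :: s' => map (cons a) (subs s' j') ++ subs s' j
  end.

Lemma size_subs (s : seq nat) (j : nat) : size (subs s j) = 'C(size s, j).
Proof.
elim: s j => [|a s IH] [|j] //=.
by rewrite size_cat size_map !IH binS addnC.
Qed.

Lemma mem_subs (u s : seq nat) (j : nat) :
  (u \in subs s j) = subseq u s && (size u == j).
Proof.
elim: s j u => [|a s IH] [|j] u.
- by rewrite /= inE; case: u.
- by rewrite /=; case: u.
- by rewrite /= inE; case: u => //= b u; rewrite andbF.
rewrite mem_cat IH; case: u => [|b u] /=.
  by rewrite andbF orbF; apply/mapP => -[].
have -> : (b :: u \in map (cons a) (subs s j)) = (b == a) && (u \in subs s j).
  apply/mapP/andP => [[v Hv [-> ->]]|[/eqP-> Hu]]; last by exists u.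
  by rewrite eqxx.
rewrite IH eqSS; case: eqP => [->|_] //=.
case: (size u == j); rewrite ?andbF ?andbT //.
apply/orP/idP => [[]//|->]; last by left.
by move=> H; apply: subseq_trans H; exact: subseq_cons.
Qed.

Lemma subs_uniq (s : seq nat) (j : nat) : uniq s -> uniq (subs s j).
Proof.
elim: s j => [|a s IH] [|j] //= /andP[Ha us].
rewrite cat_uniq map_inj_uniq ?IH //=; last by move=> u v [].
rewrite andbT; apply/hasPn => u; rewrite mem_subs => /andP[Hu _].
apply/mapP => -[v _ e]; case/negP: Ha; apply: (mem_subseq Hu).
by rewrite e mem_head.
Qed.

Lemma count_cat_allpairs (A B : pred (seq nat)) (j : nat) (X Y : seq (seq nat)) :
  all (fun x => size x == j) X ->
  count (fun w => A (take j w) && B (drop j w)) [seq x ++ y | x <- X, y <- Y] =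
  count A X * count B Y.
Proof.
elim: X => //= x X IH /andP[/eqP Hx HX].
rewrite count_cat IH // mulnDl count_map; congr (_ + _).
rewrite (eq_count (a2 := fun y => A x && B y)); last first.
  by move=> y /=; rewrite take_size_cat // drop_size_cat.
by case: (A x); rewrite ?mul1n // count_pred0.
Qed.

Lemma permutations_split (s : seq nat) (j : nat) : uniq s -> j <= size s ->
  perm_eq (permutations s)
    [seq w | u <- subs s j,
             w <- [seq x ++ y | x <- permutations u,
                               y <- permutations [seq z <- s | z \notin u]]].
Proof.
move=> us js.
have Hf u : u \in subs s j -> u = [seq z <- s | z \in u] /\ size u = j.
  by rewrite mem_subs => /andP[/(subseq_uniqP us) Hu /eqP Hj].
apply: uniq_perm; first exact: permutations_uniq.
  apply: allpairs_uniq_dep; first exact: subs_uniq.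
    move=> u Hu; apply: allpairs_uniq; rewrite ?permutations_uniq //.
    move=> [x y] [x' y'] /allpairsP[[? ?] /= [Hx _ [-> ->]]].
    move=> /allpairsP[[? ?] /= [Hx' _ [-> ->]]] /eqP.
    move: Hx Hx'; rewrite !mem_permutations => /perm_size Hx /perm_size Hx'.
    by rewrite eqseq_cat ?Hx ?Hx' // => /andP[/eqP-> /eqP->].
  move=> [u w] [u' w'] /allpairsPdep[? [? [Hu Hw /= [-> ->]]]].
  move=> /allpairsPdep[? [? [Hu' Hw' /= [-> ->]]]] /= e.
  (* The subset can be recovered from the word, as the letters of [s] among its first [j] ones;
     hence blocks of different subsets are disjoint. *)
  have Hux : forall v w, v \in subs s j ->
      w \in [seq x ++ y | x <- permutations v,
               y <- permutations [seq z <- s | z \notin v]] ->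
      v = [seq z <- s | z \in take j w].
    move=> v z Hv /allpairsP[[x y] /= [Hx _ ->]].
    have [Hv1 Hj] := Hf v Hv; rewrite mem_permutations in Hx.
    rewrite -Hj take_size_cat ?(perm_size Hx) // [LHS]Hv1; apply: eq_filter => a.
    by rewrite (perm_mem Hx).
  by rewrite e in Hw *; rewrite (Hux _ _ Hu Hw) (Hux _ _ Hu' Hw').
move=> w; rewrite mem_permutations; apply/idP/allpairsPdep.
  move=> Hw; have uw : uniq w by rewrite (perm_uniq Hw).
  have Hp : perm_eq (take j w) [seq z <- s | z \in take j w].
    apply: uniq_perm; rewrite ?filter_uniq ?take_uniq // => z.
    rewrite mem_filter; case: (boolP (z \in take j w)) => //= /mem_take.
    by rewrite (perm_mem Hw) => ->.
  exists [seq z <- s | z \in take j w], w; split=> //.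
    rewrite mem_subs filter_subseq -(perm_size Hp) size_takel ?eqxx //.
    by rewrite (perm_size Hw).
  apply/allpairsP; exists (take j w, drop j w); rewrite /= cat_take_drop.
  split=> //; rewrite mem_permutations //.
  apply: uniq_perm; rewrite ?filter_uniq ?drop_uniq // => z.
  rewrite mem_filter -(perm_mem Hp) -(perm_mem Hw).
  move: uw; rewrite -[w in _ = _ && (_ \in w)](cat_take_drop j).
  rewrite -{1}(cat_take_drop j w) mem_cat cat_uniq.
  move=> /and3P[_ /hasPn Hd _]; case: (boolP (z \in drop j w)) => [/Hd ->|_].
    by rewrite orbT.
  by rewrite orbF andNb.
move=> [u [v [Hu /allpairsP[[x y] /= [Hx Hy ->]] ->]]].
rewrite !mem_permutations in Hx Hy.
apply: (perm_trans (perm_cat Hx Hy)).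
rewrite {1}(Hf u Hu).1; exact/permPl/perm_filterC.
Qed.

Lemma count_split (A B : pred (seq nat)) (s : seq nat) (j : nat) :
  uniq s -> j <= size s ->
  count (fun w => A (take j w) && B (drop j w)) (permutations s) =
  \sum_(u <- subs s j) count A (permutations u) *
                       count B (permutations [seq z <- s | z \notin u]).
Proof.
move=> us js; rewrite (seq.permP (permutations_split us js)) count_flatten.
rewrite -map_comp sumnE big_map !big_seq; apply: eq_bigr => u.
rewrite mem_subs => /andP[_ /eqP Hu] /=; rewrite map_id count_cat_allpairs //.
by apply/allP => x; rewrite mem_permutations => /perm_size ->; rewrite Hu.
Qed.

(** * Words headed by their least letter *)

Lemma count_head_min (A : pred (seq nat)) (a : nat) (s : seq nat) :
  (forall x w, A (x :: w) -> all (ltn x) w) ->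
  all (ltn a) s -> uniq s ->
  count A (permutations (a :: s)) = count (fun w => A (a :: w)) (permutations s).
Proof.
move=> HA /allP Ha us; rewrite -!size_filter.
rewrite -[RHS](size_map (cons a)); apply: perm_size; apply: uniq_perm.
- exact: filter_uniq (permutations_uniq _).
- rewrite map_inj_uniq; first exact: filter_uniq (permutations_uniq _).
  by move=> u v [].
move=> w; rewrite mem_filter mem_permutations; apply/andP/mapP; last first.
  move=> [v]; rewrite mem_filter mem_permutations => /andP[Hv Hp] ->.
  by rewrite perm_cons.
case: w => [|x w] [Aw Hp]; first by move/perm_size: Hp.
have Hx : x = a.
  apply/eqP; apply/negP => /negP xa.
  have : x \in a :: s by rewrite -(perm_mem Hp) mem_head.
  rewrite inE (negbTE xa) /= => /Ha ax.
  have : a \in x :: w by rewrite (perm_mem Hp) mem_head.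
  rewrite inE eq_sym (negbTE xa) /= => /(allP (HA _ _ Aw)).
  by move: ax => /=; lia.
subst x; exists w => //; rewrite mem_filter Aw mem_permutations.
by rewrite -(perm_cons a).
Qed.

(** The first occurrence [x b c d] gives [x < c < d < b], and the rest is a cluster starting at [c]
    or [d], which by induction lies below everything after it. *)
Lemma cluster_min (l x : nat) (w : seq nat) : cluster l (x :: w) -> all (ltn x) w.
Proof.
elim: l x w => [|l IH] x w; first by case: w.
rewrite clusterS => /andP[/and4P[]].
case: w => [|b [|c [|d w]]] //= _ xc cd db Hl.
have {}Hl : all (ltn c) w.
  case/orP: Hl => [/IH|/andP[_ /IH /= /andP[_]] //].
  by apply: sub_all => y /=; lia.
rewrite (sub_all _ Hl) => [|y /=]; lia.
Qed.

(** * Initial runs of occurrences overlapping in two letters *)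

Fixpoint zigocc (k : nat) (w : seq nat) : bool :=
  if k is k'.+1 then occ w 0 && zigocc k' (drop 2 w) else true.

(** The [k] occurrences start at 0, 2, ..., [2 * k - 2], so index [2 * k + 1] holds the last letter
    of the run, the only letter shared with what follows. *)
Definition lead (k m : nat) (w : seq nat) : bool :=
  zigocc k w && cluster m (drop k.*2.+1 w).

Lemma leadS (k m : nat) (w : seq nat) :
  lead k.+1 m w = occ w 0 &&
    (if k is 0 then cluster m (drop 3 w) else lead k m (drop 2 w)).
Proof.
rewrite /lead /= -andbA drop_drop; case: k => [|k] //=.
by rewrite (_ : _ + 2 = k.+2.*2.+1) //; lia.
Qed.

(* The index k counts the occurrences of the initial run in which consecutive
   occurrences overlap in two letters. *)
Lemma cluster_lead (l : nat) (w : seq nat) : 0 < l ->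
  cluster l w = \sum_(1 <= k < l.+1) lead k (l - k) w :> nat.
Proof.
elim: l w => // l IH w _.
rewrite clusterS big_nat_recl // leadS subSS subn0.
have [o0|o0] /= := boolP (occ w 0); last first.
  by rewrite big1_seq // => k _; rewrite leadS (negbTE o0).
have -> : \sum_(1 <= k < l.+1) lead k.+1 (l.+1 - k.+1) w =
          \sum_(1 <= k < l.+1) lead k (l - k) (drop 2 w).
  apply: eq_big_nat => k /andP[k0 _]; rewrite leadS o0 subSS.
  by case: k k0.
case: l IH => [|l] IH; first by rewrite big_geq // orbF addn0.
(* The term [k = 1] ends the run after one occurrence; the others prolong it by a run starting two
   letters later. These cases exclude each other, so the disjunction is a sum. *)
rewrite -IH // andTb; have := @cluster_disjoint l.+1 w.
by case: (cluster _ (drop 3 w)) => [/(_ isT isT) ->|]; rewrite ?addn0.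
Qed.

(* Sorts the first [2 k + 2] letters of a word counted by [zigocc k]. *)
Fixpoint zig (k : nat) (w : seq nat) : seq nat :=
  match k, w with
  | k'.+1, a :: b :: w' => a :: rcons (zig k' w') b
  | _, _ => take 2 w
  end.

Lemma perm_zig (k : nat) (w : seq nat) :
  k.+1.*2 <= size w -> perm_eq (zig k w) (take k.+1.*2 w).
Proof.
elim: k w => [|k IH] w //.
case: w => [|a [|b w]] //=; rewrite doubleS !ltnS => H.
rewrite perm_cons perm_rcons perm_cons; exact: IH.
Qed.

Lemma size_zig (k : nat) (w : seq nat) :
  k.+1.*2 <= size w -> size (zig k w) = k.+1.*2.
Proof. by move=> H; rewrite (perm_size (perm_zig H)) size_takel. Qed.

Lemma zig_inj (k : nat) (v w : seq nat) : k.+1.*2 <= size v -> k.+1.*2 <= size w ->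
  zig k v = zig k w -> take k.+1.*2 v = take k.+1.*2 w.
Proof.
elim: k v w => [|k IH] v w //.
case: v => [|a [|b v]] //; case: w => [|c [|d w]] //=; rewrite !doubleS !ltnS.
by move=> Hv Hw [-> /rcons_inj[/IH H ->]]; rewrite -doubleS H.
Qed.

Lemma head_zig (k : nat) (w : seq nat) :
  k.+1.*2 <= size w -> head 0 (zig k w) = nth 0 w 0.
Proof. by case: k w => [|k] [|a [|b w]]. Qed.

Lemma last_zig (k : nat) (w : seq nat) :
  k.+1.*2 <= size w -> last 0 (zig k w) = nth 0 w 1.
Proof. by case: k w => [|k] [|a [|b [|c w]]] //= H; rewrite last_rcons. Qed.

(** The [k + 1] letters a_1, a_3, ..., a_(2k+1) come first in [zig], so the last letter a_(2k+2) of
    the run lands at index [k + 1]. *)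
Lemma nth_zig (k : nat) (w : seq nat) :
  k.+1.*2 <= size w -> nth 0 (zig k w) k.+1 = nth 0 w k.*2.+1.
Proof.
elim: k w => [|k IH] [|a [|b w]] //; rewrite [size _]/= doubleS !ltnS => H.
by rewrite /= nth_rcons size_zig // -IH // ifT //; lia.
Qed.

(** A new occurrence [a b c d] in front wraps [a] and [b] around the sorted inner list, whose ends
    are [c] and [d]; it adds exactly [a < c] and [d < b]. *)
Lemma sorted_zig (k : nat) (w : seq nat) : 0 < k -> k.+1.*2 <= size w ->
  zigocc k w = sorted ltn (zig k w).
Proof.
elim: k w => // k IH [|a [|b w]] //= _; rewrite doubleS !ltnS => H.
rewrite ?drop0 -cats1 cat_path /= andbT.
have Hh := head_zig H; have Hl := last_zig H.
have Hs := size_zig H.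
have -> : path ltn a (zig k w) = (a < nth 0 w 0) && sorted ltn (zig k w).
  by rewrite -Hh; case: (zig k w) Hs.
have -> : last a (zig k w) = nth 0 w 1 by rewrite -Hl; case: (zig k w) Hs.
rewrite /occ /= {Hh Hl Hs}.
case: k IH H => [|k] IH H.
  by case: w H => [|c [|d w]] //= _; rewrite take0 /= !andbT -andbA.
(* The remaining inequality [c < d] follows from the first occurrence of the inner run. *)
rewrite -IH //; case: (boolP (zigocc _ _)) => [/andP[/and4P[_ H1 H2 H3] _]|_];
  rewrite ?andbF // !andbT.
rewrite !add0n in H1 H2 H3 *; rewrite doubleS in H.
have -> : 4 <= (size w).+2 by move: H; rewrite !ltnS; lia.
by rewrite (ltn_trans H1 (ltn_trans H2 H3)).
Qed.

(** * Sorting the initial run, and the recurrence for the number of clusters *)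

Definition unzig (k : nat) (w : seq nat) : seq nat := zig k w ++ drop k.+1.*2 w.

Lemma perm_unzig (k : nat) (w : seq nat) :
  k.+1.*2 <= size w -> perm_eq (unzig k w) w.
Proof.
by move=> H; rewrite -[X in perm_eq _ X](cat_take_drop k.+1.*2) perm_cat2r perm_zig.
Qed.

Lemma unzig_inj (k n : nat) (v w : seq nat) : k.+1.*2 <= n ->
  size v = n -> size w = n -> unzig k v = unzig k w -> v = w.
Proof.
move=> H Hv Hw /eqP; rewrite eqseq_cat ?size_zig ?Hv ?Hw //.
move=> /andP[/eqP/zig_inj e /eqP e'].
by rewrite -[v](cat_take_drop k.+1.*2) e ?Hv ?Hw // e' cat_take_drop.
Qed.

(** An increasing segment with a cluster branching off at index [i]: [i] letters of the segment lie
    below the branching letter and [k] above. A free [i] allows induction by removing the least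
    letter. *)
Definition fan (i k m : nat) (z : seq nat) : bool :=
  sorted ltn (take (i + k).+1 z) && cluster m (nth 0 z i :: drop (i + k).+1 z).

Lemma lead_unzig (k m : nat) (w : seq nat) : 0 < k -> k.+1.*2 <= size w ->
  lead k m w = fan k.+1 k m (unzig k w).
Proof.
move=> k0 H; rewrite /lead /fan sorted_zig // /unzig.
have -> : (k.+1 + k).+1 = k.+1.*2 by rewrite addSn addnn.
rewrite take_size_cat ?size_zig // drop_size_cat ?size_zig //.
rewrite nth_cat size_zig // ifT; last by rewrite -addnn; lia.
by rewrite nth_zig // (drop_nth 0).
Qed.

Lemma fan_min (i k m x : nat) (w : seq nat) :
  fan i k m (x :: w) -> all (ltn x) w.
Proof.
case/andP => /=; rewrite (path_sortedE ltn_trans) => /andP[Hx _] Hch.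
rewrite -[w](cat_take_drop (i + k)) all_cat Hx /=.
case: i Hx Hch => [|i] Hx /=; first by move/cluster_min.
move=> /cluster_min /allP Hd; apply/allP => y Hy.
(* Otherwise [nth] would return its default 0; but then the dropped part, which contains [y], would
   be empty. *)
have Hi : i < size w.
  rewrite ltnNge; apply/negP => wi; move: Hy; rewrite drop_oversize //; lia.
have Hni : nth 0 w i \in take (i.+1 + k) w.
  have ik : i < i.+1 + k by lia.
  by rewrite -(nth_take 0 ik) mem_nth // size_take_min leq_min ik.
by have := allP Hx _ Hni; have := Hd y Hy; rewrite /=; lia.
Qed.

Lemma count_sorted (u : seq nat) : sorted ltn u ->
  count (sorted ltn) (permutations u) = 1.
Proof.
move=> su; rewrite (eq_in_count (a2 := pred1 u)).
  by rewrite count_uniq_mem ?permutations_uniq // mem_permutations perm_refl.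
move=> w; rewrite mem_permutations /= => Hw; apply/idP/eqP => [sw|-> //].
apply: (irr_sorted_eq ltn_trans ltnn sw su); exact: perm_mem.
Qed.

Definition cluster_num (n l : nat) : nat := count (cluster l) (permutations (iota 1 n)).

Lemma count_cluster (l : nat) (s : seq nat) : sorted ltn s ->
  count (cluster l) (permutations s) = cluster_num (size s) l.
Proof.
move=> ss; apply: count_order_inv; rewrite ?size_iota //; first exact: order_inv_cluster.
exact: iota_ltn_sorted.
Qed.

(** The least letter comes first; any [k] of the others may form the rest of the segment, in one
    order, and the unchosen ones continue the cluster. *)
Lemma count_fan0 (k m : nat) (s : seq nat) : sorted ltn s -> k < size s ->
  count (fan 0 k m) (permutations s) = 'C((size s).-1, k) * cluster_num (size s - k) m.
Proof.
case: s => // a s /=; rewrite (path_sortedE ltn_trans) ltnS => /andP[Ha ss] ks.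
have us := sorted_ltn_uniq ss.
rewrite count_head_min //; last by move=> x w; exact: fan_min.
rewrite (eq_in_count (a2 := fun w => sorted ltn (take k w) && cluster m (a :: drop k w))); last first.
  move=> w; rewrite mem_permutations => Hw.
  rewrite /fan /= add0n (path_sortedE ltn_trans).
  suff -> : all (ltn a) (take k w) by [].
  apply/allP => y /mem_take; rewrite (perm_mem Hw); exact: (allP Ha).
rewrite (count_split (sorted ltn) (fun v => cluster m (a :: v))) //.
rewrite -size_subs -sum1_size big_distrl /= !big_seq.
apply: eq_bigr => u; rewrite mem_subs => /andP[Hu /eqP Huk].
rewrite count_sorted; last exact: (subseq_sorted ltn_trans Hu).
(* Putting [a] back among the unchosen letters costs nothing, since a cluster on them must start
   with its least letter [a]. *)
rewrite !mul1n -count_head_min ?filter_uniq //; first last.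
- by apply/allP => y; rewrite mem_filter => /andP[_]; exact: (allP Ha).
- by move=> x w; exact: cluster_min.
rewrite count_cluster /=; last first.
  rewrite (path_sortedE ltn_trans) sorted_filter // ?andbT; last exact: ltn_trans.
  by apply/allP => y; rewrite mem_filter => /andP[_]; exact: (allP Ha).
congr cluster_num; rewrite subSn //; congr _.+1.
have /(subseq_uniqP us) e := Hu.
have := count_predC (mem u) s; rewrite -!size_filter -e Huk => <-.
by rewrite addKn.
Qed.

(** The [i] letters before the branching point are forced to be the least ones, in order; they are
    removed one at a time. *)
Lemma count_fan (i k m : nat) (s : seq nat) : sorted ltn s -> i + k < size s ->
  count (fan i k m) (permutations s) =
  'C((size s - i).-1, k) * cluster_num (size s - i - k) m.
Proof.
elim: i s => [|i IH] s ss ks; first by rewrite count_fan0 // subn0.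
case: s ss ks => // a s /=; rewrite (path_sortedE ltn_trans) => /andP[Ha ss].
rewrite addSn ltnS subSS => ks; have us := sorted_ltn_uniq ss.
rewrite count_head_min //; last by move=> x w; exact: fan_min.
rewrite -IH //; apply: eq_in_count => w; rewrite mem_permutations => Hw.
rewrite /fan /= addSn (path_sortedE ltn_trans).
suff -> : all (ltn a) (take (i + k).+1 w) by [].
apply/allP => y /mem_take; rewrite (perm_mem Hw); exact: (allP Ha).
Qed.

Lemma zigocc_size (k : nat) (w : seq nat) : 0 < k -> zigocc k w -> k.+1.*2 <= size w.
Proof.
elim: k w => // k IH w _ /= /andP[/occ_size H].
case: k IH => [|k] IH; first by rewrite add0n in H.
move=> /(IH _ isT); rewrite size_drop !doubleS; lia.
Qed.

(** When the run fits, [unzig k] permutes the arrangements of 1, ..., n, and [count_fan] applies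
    with [i = k + 1], whence [n - k - 2] and [n - 2 * k - 1]. *)
Lemma count_lead (k m n : nat) : 0 < k ->
  count (lead k m) (permutations (iota 1 n)) =
  (2 * k + 2 <= n) * ('C(n - k - 2, k) * cluster_num (n - 2 * k - 1) m).
Proof.
move=> k0; have sz w : w \in permutations (iota 1 n) -> size w = n.
  by rewrite mem_permutations => /perm_size; rewrite size_iota.
have E2 : 2 * k + 2 = k.+1.*2 by rewrite -muln2; lia.
rewrite E2; case: (leqP k.+1.*2 n) => Hn; last first.
  rewrite /= mul0n (eq_in_count (a2 := pred0)) ?count_pred0 // => w /sz Hw /=.
  by apply/negP => /andP[/(zigocc_size k0)]; rewrite Hw leqNgt Hn.
rewrite /= mul1n (eq_in_count (a2 := preim (unzig k) (fan k.+1 k m))); last first.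
  by move=> w /sz Hw /=; rewrite lead_unzig ?Hw.
rewrite -count_map.
have P : perm_eq (map (unzig k) (permutations (iota 1 n))) (permutations (iota 1 n)).
  apply: perm_map_permutations; rewrite ?iota_uniq //.
    by move=> u v /sz Hu /sz Hv; exact: unzig_inj Hn Hu Hv.
  move=> w Hw; apply: perm_trans (perm_unzig _) _; first by rewrite sz.
  by rewrite -mem_permutations.
rewrite (seq.permP P) count_fan ?iota_ltn_sorted // size_iota; last lia.
by congr ('C(_, _) * cluster_num _ _); lia.
Qed.

Lemma cluster_num_rec (n l : nat) : 0 < l ->
  cluster_num n l = \sum_(1 <= k < l.+1 | 2 * k + 2 <= n)
              'C(n - k - 2, k) * cluster_num (n - 2 * k - 1) (l - k).
Proof.
move=> l0; rewrite [RHS]big_mkcond /= {1}/cluster_num -sum1_count big_mkcond /=.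
rewrite (eq_bigr (fun w => \sum_(1 <= k < l.+1) lead k (l - k) w)); last first.
  by move=> w _; rewrite -cluster_lead //; case: (cluster l w).
rewrite exchange_big /=; apply: eq_big_nat => k /andP[k0 _].
have := count_lead (l - k) n k0; rewrite -sum1_count big_mkcond /=.
rewrite (eq_bigr (fun w => lead k (l - k) w : nat)) => [->|w _].
  by case: ifP => _; rewrite ?mul1n ?mul0n.
by case: (lead _ _ _).
Qed.

(** * Binomial convolution, the two counting sequences and their boundary values *)

Lemma count_split_order_inv (A B : pred (seq nat)) (n j : nat) :
  order_inv A -> order_inv B -> j <= n ->
  count (fun w => A (take j w) && B (drop j w)) (permutations (iota 1 n)) =
  'C(n, j) * (count A (permutations (iota 1 j)) *
              count B (permutations (iota 1 (n - j)))).
Proof.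
move=> HA HB jn; have ss : sorted ltn (iota 1 n) by exact: iota_ltn_sorted.
have us := iota_uniq 1 n.
rewrite count_split ?size_iota // -[X in 'C(X, _)](size_iota 1 n) -size_subs.
rewrite -sum1_size big_distrl /= !big_seq.
apply: eq_bigr => u; rewrite mem_subs mul1n => /andP[Hu /eqP Huj].
have /(subseq_uniqP us) e := Hu.
congr (_ * _); apply: count_order_inv => //; rewrite ?iota_ltn_sorted ?size_iota //.
- exact: (subseq_sorted ltn_trans Hu).
- by rewrite sorted_filter //; exact: ltn_trans.
have := count_predC (mem u) (iota 1 n).
by rewrite -!size_filter -e Huj size_iota => En; rewrite -[X in _ = X - _]En addKn.
Qed.

Definition avoiding_num (n : nat) : nat := count avoidb (permutations (iota 1 n)).

Lemma avoid_numE (n : nat) : avoid_num [:: p1423] n = avoiding_num n.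
Proof.
rewrite /avoiding_num -card_Sn_word; apply: eq_card => s; rewrite !inE.
by apply/asboolP/idP => /avoidsP.
Qed.

Lemma chain_numE (n l : nat) : chain_num [:: p1423] n l%:Z = cluster_num n l.
Proof.
rewrite /cluster_num -card_Sn_word; apply: eq_card => s; rewrite !inE.
by apply/asboolP/idP => /is_chainE.
Qed.

Lemma cluster_num_eq0 (n l : nat) : n != 1 -> n <= 2 * l + 1 -> cluster_num n l = 0.
Proof.
move=> n1 nl; rewrite /cluster_num (eq_in_count (a2 := pred0)) ?count_pred0 // => w.
rewrite mem_permutations => /perm_size; rewrite size_iota => Hw.
by apply/negP => /cluster_size; rewrite Hw; lia.
Qed.

Lemma cluster_num_l0 (n : nat) : cluster_num n 0 = (n == 1).
Proof.
rewrite /cluster_num (eq_in_count (a2 := fun=> n == 1)).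
  by case: eqP => [->|_]; rewrite ?count_predT ?count_pred0.
by move=> w; rewrite mem_permutations => /perm_size /=; rewrite size_iota => ->.
Qed.

Lemma cluster_num_1 (l : nat) : cluster_num 1 l = (l == 0).
Proof.
case: l => [|l]; first exact: cluster_num_l0.
rewrite /cluster_num (eq_in_count (a2 := pred0)) ?count_pred0 // => w.
rewrite mem_permutations => /perm_size; rewrite size_iota => Hw.
by apply/negP => /cluster_size; rewrite Hw; lia.
Qed.

(** * The signed sum over factorizations into a cluster and an avoiding word *)

Local Open Scope ring_scope.

(** The cut-off [N] serves as induction parameter; once [N >= size u] no cluster is missed, by
    [cluster_size]. *)
Definition signed_cluster (N : nat) (u : seq nat) : rat :=
  \sum_(l < N) (-1) ^+ l * (cluster l u)%:R.

Lemma signed_clusterS (N : nat) (u : seq nat) :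
  signed_cluster N.+1 u = (size u == 1%N)%:R -
    (occ u 0)%:R * (signed_cluster N (drop 3 u) + signed_cluster N (drop 2 u)).
Proof.
rewrite /signed_cluster big_ord_recl expr0 mul1r -big_split big_distrr -sumrN.
congr (_ + _); apply: eq_bigr => l _.
rewrite lift0 clusterS exprS /= -mulrDr.
case: (boolP (occ u 0)) => o0; last by rewrite !mul0r mulr0 oppr0.
rewrite mul1r -mulrA mulN1r; congr (- (_ * _)).
have := @cluster_disjoint l u; case: (nat_of_ord l) => [|l']; last first.
  rewrite ltn0Sn andTb.
  by case: (cluster _ (drop 3 u)) => [/(_ isT isT) ->|_]; rewrite ?addr0 ?add0r.
(* For a single occurrence the [drop 2] term vanishes: [u] has at least four letters, so two or more
   remain. *)
move=> _ /=; rewrite orbF [size (drop 2 u) == _](_ : _ = false) ?addr0 //.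
by have := occ_size o0; rewrite size_drop; lia.
Qed.

Lemma signed_cluster_nil (N : nat) : signed_cluster N [::] = 0.
Proof.
rewrite /signed_cluster big1 // => l _.
by case: (nat_of_ord l) => [|l']; rewrite mulr0.
Qed.

Lemma signed_cluster_size1 (N : nat) (u : seq nat) :
  size u = 1%N -> signed_cluster N.+1 u = 1.
Proof.
move=> Hu; rewrite signed_clusterS Hu eqxx.
case: (boolP (occ u 0)) => [/occ_size|]; first by rewrite Hu.
by rewrite mul0r subr0.
Qed.

Definition signed_split (N : nat) (w : seq nat) : rat :=
  \sum_(0 <= j < (size w).+1) signed_cluster N (take j w) * (avoidb (drop j w))%:R.

Lemma signed_split_drop (N k : nat) (w : seq nat) : (k <= size w)%N ->
  signed_split N (drop k w) = \sum_(k <= j < (size w).+1)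
    signed_cluster N (drop k (take j w)) * (avoidb (drop j w))%:R.
Proof.
move=> kw; rewrite -[X in index_iota X](add0n k) big_addn /signed_split.
rewrite size_drop subSn //; apply: eq_bigr => i _.
by rewrite take_drop drop_drop.
Qed.

Lemma sum_size_take1 (w : seq nat) : (0 < size w)%N ->
  \sum_(0 <= j < (size w).+1) (size (take j w) == 1%N)%:R *
     (avoidb (drop j w))%:R = (avoidb (drop 1 w))%:R :> rat.
Proof.
move=> Hw; rewrite big_ltn // big_ltn // take0 mul0r add0r size_takel // mul1r.
rewrite big_nat big1 ?addr0 // => j /andP[j1 jw].
by rewrite size_takel // (_ : (j == 1%N) = false) ?mul0r //; lia.
Qed.

(** Induction by stripping the first occurrence. The one-letter cluster contributes the avoidance of
    [drop 1 w], which is that of [w] if no occurrence starts at 0; otherwise the other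
    factorizations cancel it. *)
Lemma signed_splitE (N : nat) (w : seq nat) : (0 < size w <= N)%N ->
  signed_split N w = (avoidb w)%:R.
Proof.
elim: N w => [|N IH] w; first by lia.
move=> /andP[w0 wN]; rewrite /signed_split.
rewrite (eq_bigr (fun j => (size (take j w) == 1%N)%:R * (avoidb (drop j w))%:R -
    (occ (take j w) 0)%:R * ((signed_cluster N (drop 3 (take j w)) +
        signed_cluster N (drop 2 (take j w))) * (avoidb (drop j w))%:R))); last first.
  by move=> j _; rewrite signed_clusterS mulrBl mulrA.
rewrite sumrB sum_size_take1 // [in RHS]avoidb_behead.
case: (boolP (occ w 0)) => o0; last first.
  by rewrite big1 ?subr0 // => j _; rewrite occ_take (negbTE o0) andbF mul0r.
have w4 := occ_size o0; rewrite add0n in w4.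
have -> : avoidb (drop 1 w) = avoidb (drop 2 w).
  by rewrite avoidb_behead occ_drop addn0 occ_succ // drop_drop.
rewrite (big_cat_nat (n := 4)) //=; last by lia.
rewrite big_nat big1 ?add0r => [|j /andP[_ j4]]; last first.
  by rewrite occ_take leqNgt j4 mul0r.
rewrite (eq_big_nat _ _ (F2 := fun j =>
    signed_cluster N (drop 3 (take j w)) * (avoidb (drop j w))%:R +
    signed_cluster N (drop 2 (take j w)) * (avoidb (drop j w))%:R)); last first.
  by move=> j /andP[j4 _]; rewrite occ_take j4 o0 mul1r mulrDl.
rewrite big_split /=.
(* In the sum for [drop 3 w] the cut at 3 leaves an empty prefix, of weight 0, so the terms from 4
   on make up the whole sum. *)
have E3 := signed_split_drop N (ltnW w4).
rewrite IH ?size_drop in E3; last by lia.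
rewrite big_ltn in E3; last by lia.
rewrite [drop 3 (take 3 w)]drop_oversize ?size_takel ?(ltnW w4) // in E3.
rewrite signed_cluster_nil mul0r add0r in E3; rewrite -E3.
(* In the sum for [drop 2 w] the cut at 3 leaves a one-letter prefix of weight 1. This extra term is
   the avoidance of [drop 3 w], so the two sums from 4 on add up to the avoidance of [drop 2 w]. *)
have w2 : (2 <= size w)%N by lia.
have E2 := signed_split_drop N w2; rewrite IH ?size_drop in E2; last by lia.
rewrite big_ltn in E2; last by lia.
rewrite big_ltn in E2; last by lia.
rewrite [drop 2 (take 2 w)]drop_oversize ?size_takel // in E2.
rewrite signed_cluster_nil mul0r add0r in E2.
case: N wN {IH E3} E2 => [|N] wN E2; first by lia.
rewrite signed_cluster_size1 in E2; last by rewrite size_drop size_takel //; lia.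
by rewrite mul1r in E2; rewrite E2 subrr.
Qed.

(** * Signed cluster numbers, the integer-indexed recurrence and the generating function *)

Definition kappa (N j : nat) : rat := \sum_(l < N) (-1) ^+ l * (cluster_num j l)%:R.

Lemma sum_count (A : pred (seq nat)) (s : seq (seq nat)) :
  \sum_(w <- s) (A w)%:R = (count A s)%:R :> rat.
Proof.
by elim: s => [|w s IH]; rewrite ?big_nil // big_cons IH /= natrD.
Qed.

(** This is [signed_splitE] summed over all permutations, with the sum over words moved
    innermost. *)
Lemma avoiding_num_kappa (n : nat) : (0 < n)%N ->
  (avoiding_num n)%:R = \sum_(j < n.+1) 'C(n, j)%:R * kappa n j * (avoiding_num (n - j))%:R :> rat.
Proof.
move=> n0; rewrite -sum_count.
have sz w : w \in permutations (iota 1 n) -> size w = n.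
  by rewrite mem_permutations => /perm_size; rewrite size_iota.
transitivity (\sum_(w <- permutations (iota 1 n)) \sum_(j < n.+1) \sum_(l < n)
    (-1) ^+ l * (cluster l (take j w) && avoidb (drop j w))%:R : rat).
  rewrite big_seq [RHS]big_seq; apply: eq_bigr => w /sz Hw.
  rewrite -(@signed_splitE n) ?Hw ?n0 ?leqnn // /signed_split big_mkord Hw.
  apply: eq_bigr => j _; rewrite /signed_cluster big_distrl; apply: eq_bigr => l _ /=.
  by rewrite -mulrA -natrM mulnb.
rewrite exchange_big /=; apply: eq_bigr => j _.
rewrite exchange_big /= /kappa big_distrr big_distrl /=; apply: eq_bigr => l _.
rewrite -big_distrr /= (sum_count (fun w => cluster l (take j w) && avoidb (drop j w))).
rewrite (@count_split_order_inv (cluster l) avoidb) ?natrM //; last by rewrite -ltnS.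
- by rewrite mulrCA !mulrA.
- exact: order_inv_cluster.
- exact: order_inv_avoidb.
Qed.

Lemma kappa_widen (N M j : nat) : (j <= N)%N -> (N <= M)%N ->
  (0 < N)%N -> kappa M j = kappa N j.
Proof.
move=> jN NM N0; rewrite /kappa -!(big_mkord xpredT (fun l => (-1) ^+ l * (cluster_num j l)%:R : rat)).
rewrite (big_cat_nat (n := N)) //= [X in _ + X](_ : _ = 0) ?addr0 //.
rewrite big_nat big1 // => l /andP[Nl _].
case: (j =P 1%N) => [->|/eqP j1]; last by rewrite cluster_num_eq0 ?mulr0 //; lia.
by rewrite cluster_num_1 (_ : (l == 0%N) = false) ?mulr0 //; lia.
Qed.

Lemma cluster_num_rec_chain_num (n l : nat) : (4 <= n)%N ->
  cluster_num n l = (\sum_(1 <= k < n | 2 * k + 2 <= n)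
     'C(n - k - 2, k) * chain_num [:: p1423] (n - 2 * k - 1) (l%:Z - k%:Z)%R)%N.
Proof.
move=> n4.
have neg k : (l < k)%N -> chain_num [:: p1423] (n - 2 * k - 1) (l%:Z - k%:Z)%R = 0%N.
  by move=> lk; rewrite (_ : _ - _ = Negz (k - l).-1) //; lia.
have pos k : (k <= l)%N ->
    chain_num [:: p1423] (n - 2 * k - 1) (l%:Z - k%:Z)%R = cluster_num (n - 2 * k - 1) (l - k).
  by move=> kl; rewrite -chain_numE -subzn.
case: (posnP l) => [l0|l0].
  rewrite {1}l0 cluster_num_l0 big_nat_cond big1 => [|k /andP[/andP[k1 _] _]]; first by lia.
  by rewrite neg ?muln0 ?l0.
(* Both ranges are widened to a common bound: terms with [k > l] vanish through the negative index,
   and [2 * k + 2 <= n] forces [k < n]. *)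
rewrite cluster_num_rec // (big_nat_widen _ _ (l + n)); last by lia.
rewrite [RHS](big_nat_widen _ _ (l + n)); last by lia.
rewrite big_mkcond [RHS]big_mkcond; apply: eq_bigr => k _ /=.
case: (leqP (2 * k + 2) n) => kn //=; rewrite (_ : (k < n)%N); last by lia.
by rewrite ltnS; case: (leqP k l) => kl; [rewrite pos | rewrite neg ?muln0].
Qed.

Lemma avoid_egf_inv :
  is_fps_inv
    (fps_sub (fps_sub fps_one fps_X)
       (fun n : nat => if (2 <= n)%N then
          \sum_(l \in [set l : nat | (1 <= l)%N]%classic)
             (-1 : rat) ^+ l * (chain_num [:: p1423] n l%:Z)%:R / n`!%:R
        else 0))
    (avoid_egf [:: p1423]).
Proof.
have egfE m : avoid_egf [:: p1423] m = (avoiding_num m)%:R / m`!%:R.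
  by rewrite /avoid_egf avoid_numE; case: m => //; rewrite divr1.
set f := fps_sub _ _.
have f0 : f 0%N = 1 by rewrite /f /fps_sub /fps_one /fps_X /= !subr0.
(* The term [- t] fits the same formula: it is the one-letter cluster. *)
have fE N i : (0 < i <= N)%N -> f i = - (kappa N i / i`!%:R).
  move=> /andP[i0 iN]; rewrite (kappa_widen (leqnn i) iN i0).
  rewrite /f /fps_sub /fps_one /fps_X; case: i i0 iN => [|[|i]] // _ _.
    by rewrite /= subr0 sub0r /kappa big_ord1 cluster_num_1 mulr1 divr1.
  rewrite -[i.+2 == 0%N]/false -[i.+2 == 1%N]/false subrr sub0r.
  congr (- _).
  rewrite -[LHS]/(\sum_(l \in [set l : nat | (1 <= l)%N]%classic)
     (-1 : rat) ^+ l * (chain_num [:: p1423] i.+2 l%:Z)%:R / i.+2`!%:R).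
  (* The infinite sum has finite support: on [i + 2] letters there are no clusters with [i + 2] or
     more occurrences. *)
  rewrite (fsbigE (iota 1 i.+1)) ?iota_uniq //; first last.
  - move=> l l1; rewrite mem_iota => li; rewrite mksetE in l1.
    by rewrite chain_numE cluster_num_eq0 ?mulr0 ?mul0r //; lia.
  - by move=> l; rewrite mksetE mem_iota => /andP[].
  rewrite /kappa big_ord_recl cluster_num_l0 mulr0 add0r big_distrl [RHS]/=.
  rewrite -(big_mkord xpredT (fun l => (-1) ^+ (bump 0 l) * (cluster_num i.+2 (bump 0 l))%:R / i.+2`!%:R : rat)).
  rewrite big_seq_cond (eq_bigl (fun l => l \in iota 1 i.+1)); last first.
    move=> l; rewrite mem_iota; case: (boolP (1 <= l < 1 + i.+1)%N) => //= /andP[l1 _].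
    by rewrite mem_setE.
  rewrite -big_seq /index_iota subn0 (iotaDl 1 0 i.+1) big_map.
  by apply: eq_bigr => l _; rewrite chain_numE.
move=> n; rewrite /fps_mul /fps_one; case: (posnP n) => [->|n0].
  rewrite big_ord1 f0 egfE mul1r /avoiding_num.
  by rewrite /= divr1.
rewrite big_ord_recl f0 mul1r egfE subn0 (avoiding_num_kappa n0) big_ord_recl.
rewrite [kappa n 0](_ : _ = 0) ?mulr0 ?mul0r ?add0r; last first.
  by rewrite /kappa big1 // => l _; rewrite cluster_num_eq0 ?mulr0.
rewrite big_distrl /= -big_split /= big1 ?gtn_eqF // => i _.
have : (0 < bump 0 i <= n)%N by rewrite /bump add1n /=.
move: (bump 0 i) => j jN; have /andP[_ iN] := jN.
rewrite (@fE n) // egfE -(bin_fact iN) !natrM.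
have : j`!%:R != 0 :> rat by rewrite pnatr_eq0 -lt0n fact_gt0.
have : (n - j)`!%:R != 0 :> rat by rewrite pnatr_eq0 -lt0n fact_gt0.
have : 'C(n, j)%:R != 0 :> rat by rewrite pnatr_eq0 -lt0n bin_gt0.
by move=> C0 nj0 j0; field; rewrite C0 nj0 j0.
Qed.

Local Open Scope classical_set_scope.
Local Open Scope ring_scope.

Theorem theorem4p14 :
  let P : seq (seq nat) := [:: [:: 1; 4; 2; 3]]%N in
  let c : nat -> int -> nat := chain_num P in
  [/\ forall l : int, c 1%N l = nat_of_bool (0 == l),
      forall l : int, c 2%N l = 0%N /\ c 3%N l = 0%N,
      forall (n : nat) (l : int), (4 <= n)%N -> 0 <= l ->
        c n l = (\sum_(1 <= k < n | 2 * k + 2 <= n)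
                   'C(n - k - 2, k) * c (n - 2 * k - 1) (l - k%:Z)%R)%N
    & is_fps_inv
        (fps_sub (fps_sub fps_one fps_X)
           (fun n : nat => (if (2 <= n)%N then
                       \sum_(l \in [set l : nat | (1 <= l)%N])
                         (-1 : rat) ^+ l * (c n l%:Z)%:R / n`!%:R
                     else 0) : rat))
        (avoid_egf P)].
Proof.
move=> P c; rewrite /c -[P]/[:: p1423] {c P}; split.
- by case=> [l|l] //; rewrite chain_numE cluster_num_1 eq_sym.
- case=> [l|l] //; rewrite !chain_numE.
  by case: l => [|l]; rewrite ?cluster_num_l0 // !cluster_num_eq0 //; lia.
- move=> n [l|l] // n4 _; rewrite chain_numE.
  exact: cluster_num_rec_chain_num.
exact: avoid_egf_inv.
Qed.
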